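(* Let $R$ and $R'$ be commutative unital rings. Directed homology is invariant up to isomorphism of simplicially enriched categories: if $\mathcal{S}$ and $\mathcal{T}$ are isomorphic simplicially enriched categories, then for every $n\in\mathbb{N}$ the homology bimodules $(R[\mathcal{S}],\vec{H}_n(R,\mathcal{S},R'),R'[\mathcal{S}])$ and $(R[\mathcal{T}],\vec{H}_n(R,\mathcal{T},R'),R'[\mathcal{T}])$ are isomorphic in the category of bimodules over $R$-algebras on the left and $R'$-algebras on the right.
   Context: A simplicially enriched category $\mathcal{S}$ (with a set of objects) is a category enriched over simplicial sets: hom-objects $\mathcal{S}(A,B)$ are simplicial sets and composition $\mathcal{S}(A,B)\times\mathcal{S}(B,C)\to\mathcal{S}(A,C)$, $(f,g)\mapsto g\circ f$, is a simplicial map, with restriction $\circ_n$ to $n$-simplices. A $1$-morphism $X\to Y$ is a $0$-simplex of $\mathcal{S}(X,Y)$. The path algebra $R[\mathcal{S}]$ is the free left $R$-module on all $1$-morphisms, with $R$-bilinear product determined, for $f:X\to Y$, $g:Z\to T$, by $g\times f=g\circ_0 f$ if $Z=Y$ and $0$ otherwise; it is a (generally non-unital) $R$-algebra. $C_n(R,\mathcal{S},R')$ is the free $R$-$R'$-bimodule (direct sum of copies of $R\otimes_{\mathbb{Z}}R'$) on $\bigcup_{A,B}(\mathcal{S}(A,B))_n$, with the $R[\mathcal{S}]$-$R'[\mathcal{S}]$-bimodule structure determined, for $1$-morphisms $f:X\to Y$, $g:U\to V$ and $\sigma\in(\mathcal{S}(A,B))_n$, by $f.\sigma.g=0$ if $V\ne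 A$ or $B\ne X$, and $f.\sigma.g=(s_{n-1}\cdots s_0)(f)\circ_n\sigma\circ_n(s_{n-1}\cdots s_0)(g)$ otherwise, $s_k$ being degeneracy operators. The boundary $d_n:C_n\to C_{n-1}$ ($n\ge1$; $d_0=0$) is the $R$-$R'$-linear map with $d_n(c)=\sum_{j=0}^n(-1)^j\partial_j c$ on simplices; it is a bimodule homomorphism, and $\vec{H}_n(R,\mathcal{S},R')=\ker d_n/\operatorname{im}d_{n+1}$. The category of bimodules over $R$-algebras on the left and $R'$-algebras on the right has as objects triples $(\mathbb{A},M,\mathbb{B})$ with $\mathbb{A}$ an $R$-algebra, $\mathbb{B}$ an $R'$-algebra (not necessarily unital) and $M$ an $\mathbb{A}$-$\mathbb{B}$-bimodule; a morphism $(\mathbb{A},M,\mathbb{B})\to(\mathbb{A}',M',\mathbb{B}')$ is a triple $(f,g,h)$ of an $R$-algebra morphism $f:\mathbb{A}\to\mathbb{A}'$, a group homomorphism $g:M\to M'$ and an $R'$-algebra morphism $h:\mathbb{B}\to\mathbb{B}'$ with $g(a.m.b)=f(a).g(m).h(b)$ for all $a\in\mathbb{A}$, $m\in M$, $b\in\mathbb{B}$; composition is componentwise. *)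

(* Defs.v *)
From HB Require Import structures.
From mathcomp Require Import all_boot all_algebra.
From mathcomp Require Import finmap generic_quotient ring_quotient boolp.
From mathcomp.multinomials Require Import monalg.

Set Implicit Arguments.
Unset Strict Implicit.
Unset Printing Implicit Defensive.

Import GRing.Theory.
Local Open Scope ring_scope.
Local Open Scope quotient_scope.

(* Simplicial sets, by faces and degeneracies.  In the identities below,
   [widen_ord (leqnSn _) i] is [i] seen in the next larger ordinal type and
   [lift ord0 i] is [i + 1]. *)
Local Notation up i := (widen_ord (leqnSn _) i).

Record sset := SSet {
  simp :> nat -> Type;
  face : forall n, 'I_n.+2 -> simp n.+1 -> simp n;
  deg : forall n, 'I_n.+1 -> simp n -> simp n.+1;
  face_face : forall n (i j : 'I_n.+2) (x : simp n.+2), (i <= j)%N ->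
    face i (face (lift ord0 j) x) = face j (face (up i) x);
  face_deg_lt : forall n (i : 'I_n.+2) (j : 'I_n.+1) (x : simp n.+1),
    (i <= j)%N -> face (up i) (deg (lift ord0 j) x) = deg j (face i x);
  face_deg : forall n (j : 'I_n.+1) (x : simp n), face (up j) (deg j x) = x;
  face_degS : forall n (j : 'I_n.+1) (x : simp n),
    face (lift ord0 j) (deg j x) = x;
  face_deg_gt : forall n (i : 'I_n.+2) (j : 'I_n.+1) (x : simp n.+1),
    (j < i)%N -> face (lift ord0 i) (deg (up j) x) = deg j (face i x);
  deg_deg : forall n (i j : 'I_n.+1) (x : simp n), (i <= j)%N ->
    deg (up i) (deg j x) = deg (lift ord0 j) (deg i x)
}.
Arguments face {s n} _ _.
Arguments deg {s n} _ _.

(* [degs n] is [s_{n-1} o ... o s_0]. *)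
Fixpoint degs (X : sset) (n : nat) : X 0 -> X n :=
  match n with
  | 0 => id
  | m.+1 => fun x => deg ord_max (degs m x)
  end.
Arguments degs {X} n x.

Unset Implicit Arguments.

Record smap (X Y : sset) := SMap {
  smap_fun :> forall n : nat, X n -> Y n;
  smap_face : forall n (i : 'I_n.+2) (x : X n.+1),
    smap_fun n (face i x) = face i (smap_fun n.+1 x);
  smap_deg : forall n (i : 'I_n.+1) (x : X n),
    smap_fun n.+1 (deg i x) = deg i (smap_fun n x)
}.

Arguments smap_fun {X Y} s n x.
Arguments SMap {X Y} _ _ _.

Set Implicit Arguments.

Definition sprod (X Y : sset) : sset.
Proof.
refine (@SSet (fun n => (X n * Y n)%type)
  (fun n i x => (face i x.1, face i x.2))
  (fun n i x => (deg i x.1, deg i x.2)) _ _ _ _ _ _) => n i.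
- by move=> j x le_ij; rewrite /= !face_face.
- by move=> j x le_ij; rewrite /= !face_deg_lt.
- by case=> x y; rewrite /= !face_deg.
- by case=> x y; rewrite /= !face_degS.
- by move=> j x lt_ji; rewrite /= !face_deg_gt.
- by move=> j x le_ij; rewrite /= !deg_deg.
Defined.

Definition spoint : sset.
Proof.
by refine (@SSet (fun _ => unit) (fun _ _ _ => tt) (fun _ _ _ => tt)
  _ _ _ _ _ _) => // n i; case.
Defined.

Definition smap_id (X : sset) : smap X X.
Proof. by refine (@SMap X X (fun _ => id) _ _). Defined.

Definition smap_comp (X Y Z : sset) (g : smap Y Z) (f : smap X Y) : smap X Z.
Proof.
refine (@SMap X Z (fun n => g n \o f n) _ _) => n i x /=.
- by rewrite !smap_face.
- by rewrite !smap_deg.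
Defined.

Unset Implicit Arguments.

Record secat := SECat {
  ob :> Type;
  hom : ob -> ob -> sset;
  comp : forall A B C, smap (sprod (hom A B) (hom B C)) (hom A C);
  idm : forall A, smap spoint (hom A A);
  compA : forall A B C D n (f : hom A B n) (g : hom B C n) (h : hom C D n),
    comp _ _ _ n (f, comp _ _ _ n (g, h)) =
    comp _ _ _ n (comp _ _ _ n (f, g), h);
  comp1f : forall A B n (f : hom A B n), comp _ _ _ n (idm A n tt, f) = f;
  compf1 : forall A B n (f : hom A B n), comp _ _ _ n (f, idm B n tt) = f
}.
Arguments comp {s A B C}.
Arguments hom {s} A B.
Arguments idm {s}.
Arguments compA {s A B C D n} f g h.
Arguments comp1f {s A B n} f.
Arguments compf1 {s A B n} f.

Set Implicit Arguments.

(* [g o_n f], in the usual order of composition. *)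
Definition compn (S : secat) (n : nat) (A B C : S)
  (g : hom B C n) (f : hom A B n) : hom A C n := comp n (f, g).

Unset Implicit Arguments.

Record sfunctor (S T : secat) := SFunctor {
  fob :> S -> T;
  fhom : forall A B, smap (hom A B) (hom (fob A) (fob B));
  fhom_comp : forall (A B C : S) n (g : hom B C n) (f : hom A B n),
    fhom A C n (compn g f) = compn (fhom B C n g) (fhom A B n f);
  fhom_id : forall A n (u : spoint n), fhom A A n (idm A n u) = idm (fob A) n u
}.
Arguments fhom {S T} s {A B}.
Arguments fob {S T} s A.
Arguments SFunctor {S T} _ _ _ _.

Set Implicit Arguments.

Definition sfunctor_id (S : secat) : sfunctor S S.
Proof. by refine (@SFunctor S S id (fun A B => smap_id (hom A B)) _ _). Defined.

Definition sfunctor_comp (S T U : secat)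
  (G : sfunctor T U) (F : sfunctor S T) : sfunctor S U.
Proof.
refine (@SFunctor S U (G \o F)
  (fun A B => smap_comp (fhom G) (@fhom _ _ F A B)) _ _) => /=.
- by move=> A B C n g f; rewrite !fhom_comp.
- by move=> A n u; rewrite !fhom_id.
Defined.

Definition secat_iso (S T : secat) : Prop :=
  exists (F : sfunctor S T) (G : sfunctor T S),
    sfunctor_comp G F = sfunctor_id S /\ sfunctor_comp F G = sfunctor_id T.

(* [simplices S n] is the disjoint union of the sets [hom A B n]; in
   particular [simplices S 0] is the set of all 1-morphisms of [S]. *)
Record simplices (S : secat) (n : nat) := Simplex {
  src : S;
  tgt : S;
  cell : hom src tgt n
}.
Arguments Simplex {S n src tgt} cell.

HB.instance Definition _ S n := gen_eqMixin (simplices S n).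
HB.instance Definition _ S n := gen_choiceMixin (simplices S n).

Definition face_simplex (S : secat) (n : nat) (j : 'I_n.+2)
  (s : simplices S n.+1) : simplices S n := Simplex (face j (cell s)).

Definition degs_simplex (S : secat) (n : nat) (f : simplices S 0) :
  simplices S n := Simplex (degs n (cell f)).
Arguments degs_simplex {S} n f.

Definition compo (S : secat) (n : nat) (t s : simplices S n) :
  option (simplices S n) :=
  match pselect (tgt s = src t) with
  | left e =>
      Some (Simplex (compn (cell t) (ecast B (hom (src s) B n) e (cell s))))
  | right _ => None
  end.

Arguments compo {S n} t s.

Section Malg.
Implicit Types (K : choiceType) (G H : zmodType).

Lemma morphD0 (V W : zmodType) (f : V -> W) :
  {morph f : x y / x + y} -> f 0 = 0.
Proof. by move=> fD; apply: (addrI (f 0)); rewrite -fD !addr0. Qed.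

Lemma morphDN (V W : zmodType) (f : V -> W) :
  {morph f : x y / x + y} -> {morph f : x / - x}.
Proof.
by move=> fD x; apply: (addrI (f x)); rewrite -fD !subrr (morphD0 fD).
Qed.

Lemma morphDB (V W : zmodType) (f : V -> W) :
  {morph f : x y / x + y} -> {morph f : x y / x - y}.
Proof. by move=> fD x y; rewrite fD (morphDN fD). Qed.

Lemma morphDMz (V W : zmodType) (f : V -> W) :
  {morph f : x y / x + y} -> forall m : int, {morph f : x / x *~ m}.
Proof.
move=> fD m x.
pose g : {additive V -> W} :=
  HB.pack f (GRing.isZmodMorphism.Build V W f (morphDB fD)).
exact: (raddfMz g).
Qed.

Lemma malg_ext K G H (f g : {malg G[K]} -> H) :
  {morph f : x y / x + y} -> {morph g : x y / x + y} ->
  (forall k c, f << c *g k >> = g << c *g k >>) -> f =1 g.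
Proof.
move=> fD gD fg x; rewrite (monalgE x).
rewrite (big_morph f fD (morphD0 fD)) (big_morph g gD (morphD0 gD)).
by apply: eq_bigr => k _; rewrite fg.
Qed.

Section Lift.
Variables (K : choiceType) (G H : zmodType) (phi : K -> G -> H).

(* The additive map sending [c.k] to [phi k c]. *)
Definition mlift (x : {malg G[K]}) : H := \sum_(k <- msupp x) phi k x@_k.

Hypothesis phiD : forall k, {morph phi k : c d / c + d}.

Lemma mliftw (d : {fset K}) x : (msupp x `<=` d)%fset ->
  mlift x = \sum_(k <- d) phi k x@_k.
Proof.
move=> le_d; apply/big_fset_incl => // k _ /mcoeff_outdom ->.
exact: morphD0.
Qed.

Lemma mliftD : {morph mlift : x y / x + y}.
Proof.
move=> x y; rewrite (mliftw (msuppD_le x y)).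
rewrite (mliftw (fsubsetUl (msupp x) (msupp y))).
rewrite (mliftw (fsubsetUr (msupp x) (msupp y))) -big_split /=.
by apply: eq_bigr => k _; rewrite mcoeffD phiD.
Qed.

Lemma mliftU c k : mlift << c *g k >> = phi k c.
Proof. by rewrite (mliftw msuppU_le) big_seq_fset1 mcoeffUU. Qed.
End Lift.

Lemma mlift_addf K G H (phi psi : K -> G -> H) x :
  mlift (fun k c => phi k c + psi k c) x = mlift phi x + mlift psi x.
Proof. by rewrite /mlift big_split. Qed.

Definition mscale K G H (phi : G -> H) (x : {malg G[K]}) : {malg H[K]} :=
  mlift (fun k c => << phi c *g k >>) x.

Lemma mscaleD K G H (phi : G -> H) : {morph phi : c d / c + d} ->
  {morph @mscale K G H phi : x y / x + y}.
Proof. by move=> phiD; apply: mliftD => k c d; rewrite phiD monalgUD. Qed.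

Lemma mscaleU K G H (phi : G -> H) : {morph phi : c d / c + d} ->
  forall c (k : K), mscale phi << c *g k >> = << phi c *g k >>.
Proof.
by move=> phiD c k; apply: mliftU => l d e; rewrite phiD monalgUD.
Qed.

Section Prod.
Variables (K1 K2 K3 : choiceType) (G1 G2 G3 : zmodType).
Variables (op : K1 -> K2 -> option K3) (mu : G1 -> G2 -> G3).

(* The biadditive map sending [(c.k, d.l)] to [(mu c d).(op k l)], and to [0]
   when [op k l] is undefined. *)
Definition mprod (x : {malg G1[K1]}) (y : {malg G2[K2]}) : {malg G3[K3]} :=
  mlift (fun k c => mlift (fun l d =>
    if op k l is Some m then << mu c d *g m >> else 0) y) x.

Hypothesis muDl : forall d, {morph mu^~ d : c c' / c + c'}.
Hypothesis muDr : forall c, {morph mu c : d d' / d + d'}.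

Let inD k c l : {morph (fun d : G2 =>
    if op k l is Some m then << mu c d *g m >> else 0 : {malg G3[K3]}) :
  d d' / d + d'}.
Proof. by move=> d d'; case: op => [m|]; rewrite ?addr0 // muDr monalgUD. Qed.

Let outD k y : {morph (fun c : G1 => mlift (fun l d =>
    if op k l is Some m then << mu c d *g m >> else 0 : {malg G3[K3]}) y) :
  c c' / c + c'}.
Proof.
move=> c c'; rewrite -mlift_addf; apply: eq_bigr => l _.
by case: op => [m|]; rewrite ?addr0 // muDl monalgUD.
Qed.

Lemma mprodDl y : {morph mprod^~ y : x x' / x + x'}.
Proof. by move=> x x'; rewrite /mprod mliftD. Qed.

Lemma mprodDr x : {morph mprod x : y y' / y + y'}.
Proof.
move=> y y'; rewrite /mprod -mlift_addf; apply: eq_bigr => k _.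
by rewrite mliftD.
Qed.

Lemma mprodUU c k d l : mprod << c *g k >> << d *g l >> =
  if op k l is Some m then << mu c d *g m >> else 0.
Proof. by rewrite /mprod mliftU // mliftU. Qed.
End Prod.

Lemma mprodA (K1 K2 K3 K12 K23 K : choiceType) (G1 G2 G3 G12 G23 G : zmodType)
  (op12 : K1 -> K2 -> option K12) (op12_3 : K12 -> K3 -> option K)
  (op23 : K2 -> K3 -> option K23) (op1_23 : K1 -> K23 -> option K)
  (mu12 : G1 -> G2 -> G12) (mu12_3 : G12 -> G3 -> G)
  (mu23 : G2 -> G3 -> G23) (mu1_23 : G1 -> G23 -> G) :
  (forall d, {morph mu12^~ d : x y / x + y}) ->
  (forall d, {morph mu12 d : x y / x + y}) ->
  (forall d, {morph mu23^~ d : x y / x + y}) ->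
  (forall d, {morph mu23 d : x y / x + y}) ->
  (forall d, {morph mu12_3^~ d : x y / x + y}) ->
  (forall d, {morph mu12_3 d : x y / x + y}) ->
  (forall d, {morph mu1_23^~ d : x y / x + y}) ->
  (forall d, {morph mu1_23 d : x y / x + y}) ->
  (forall a b c, mu1_23 a (mu23 b c) = mu12_3 (mu12 a b) c) ->
  (forall k l m, obind (op1_23 k) (op23 l m) =
                 obind (op12_3^~ m) (op12 k l)) ->
  forall x y z, mprod op1_23 mu1_23 x (mprod op23 mu23 y z) =
    mprod op12_3 mu12_3 (mprod op12 mu12 x y) z.
Proof.
move=> D1 D2 D3 D4 D5 D6 D7 D8 muA opA x y z.
move: x; apply: malg_ext => [x x'|x x'|k a]; rewrite ?mprodDl //.
move: y; apply: malg_ext => [y y'|y y'|l b].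
- by rewrite mprodDl // mprodDr.
- by rewrite mprodDr // mprodDl.
move: z; apply: malg_ext => [z z'|z z'|m c]; rewrite ?mprodDr //.
have mp0 w : mprod op1_23 mu1_23 w 0 = 0 by apply: morphD0; apply: mprodDr.
have mp0' w : mprod op12_3 mu12_3 0 w = 0.
  by apply: (morphD0 (f := (mprod op12_3 mu12_3)^~ w)); apply: mprodDl.
rewrite !mprodUU //; have := opA k l m.
case: (op23 l m) => [lm|] /=; case: (op12 k l) => [kl|] /=;
  rewrite ?mp0 ?mp0' ?mprodUU // ?muA.
- by move=> ->.
- by move=> ->.
- by move=> <-.
Qed.


End Malg.

Section Tensor.
Variables (A B : zmodType).

Inductive tensor_rel : {malg int[(A * B)%type]} -> Prop :=
| TensorRel0 : tensor_rel 0
| TensorRelB x y : tensor_rel x -> tensor_rel y -> tensor_rel (x - y)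
| TensorRelDl a a' b :
    tensor_rel (<< (a + a', b) >> - << (a, b) >> - << (a', b) >>)
| TensorRelDr a b b' :
    tensor_rel (<< (a, b + b') >> - << (a, b) >> - << (a, b') >>).

Definition tensor_relb (x : {malg int[(A * B)%type]}) : bool :=
  `[< tensor_rel x >].

Lemma tensor_relb_zmod : zmod_closed tensor_relb.
Proof.
split=> [|x y /asboolP rx /asboolP ry]; apply/asboolP.
- exact: TensorRel0.
- exact: TensorRelB.
Qed.

HB.instance Definition _ :=
  GRing.isZmodClosed.Build _ tensor_relb tensor_relb_zmod.

(* The tensor product over the integers, as the free abelian group on [A * B]
   modulo the biadditivity relations. *)
Definition tensor := Quotient.quot (GRing.ZmodClosed.clone _ tensor_relb _).

HB.instance Definition _ := GRing.Zmodule.on tensor.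

Definition tens (a : A) (b : B) : tensor := \pi_tensor << (a, b) >>.

Lemma tensor_piD : {morph \pi_tensor : x y / x + y}.
Proof. exact: Quotient.pi_add. Qed.

Lemma tensor_pi_eq x y : tensor_rel (x - y) -> \pi_tensor x = \pi_tensor y.
Proof.
move=> xy; apply/eqP; rewrite -(Quotient.idealrBE (GRing.ZmodClosed.clone _ tensor_relb _)).
by apply/asboolP.
Qed.

Lemma tensDl b : {morph tens^~ b : x y / x + y}.
Proof.
move=> x y; rewrite /tens -tensor_piD; apply: tensor_pi_eq.
rewrite opprD addrA; exact: TensorRelDl.
Qed.

Lemma tensDr a : {morph tens a : x y / x + y}.
Proof.
move=> x y; rewrite /tens -tensor_piD; apply: tensor_pi_eq.
rewrite opprD addrA; exact: TensorRelDr.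
Qed.

Lemma tens_ext (H : zmodType) (f g : tensor -> H) :
  {morph f : x y / x + y} -> {morph g : x y / x + y} ->
  (forall a b, f (tens a b) = g (tens a b)) -> f =1 g.
Proof.
move=> fD gD fg t; rewrite -[t]reprK; move: (repr t).
apply: malg_ext => [x y|x y|[a b] c]; rewrite ?tensor_piD ?fD ?gD //=.
have -> : << c *g (a, b) >> = << (a, b) >> *~ c :> {malg int[(A * B)%type]}.
  by rewrite -[in LHS](intz c) -(raddfMz (mkmalgU (a, b))).
rewrite (morphDMz tensor_piD) (morphDMz fD) (morphDMz gD).
by rewrite -/(tens a b) fg.
Qed.

Section Lift.
Variables (H : zmodType) (beta : A -> B -> H).

(* The additive map sending [tens a b] to [beta a b]. *)
Definition tens_lift (t : tensor) : H :=
  mlift (fun k (c : int) => beta k.1 k.2 *~ c) (repr t).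

Hypothesis betaDl : forall b, {morph beta^~ b : x y / x + y}.
Hypothesis betaDr : forall a, {morph beta a : x y / x + y}.

Let L := mlift (fun (k : A * B) (c : int) => beta k.1 k.2 *~ c).

Let LD : {morph L : x y / x + y}.
Proof. by apply: mliftD => k c d; rewrite mulrzDr. Qed.

Let LU k : L << k >> = beta k.1 k.2.
Proof. by rewrite /L mliftU // => l c d; rewrite mulrzDr. Qed.

Let L_rel x : tensor_rel x -> L x = 0.
Proof.
elim=> [|{}x y _ Lx _ Ly|a a' b|a b b'].
- exact: morphD0.
- by rewrite (morphDB LD) Lx Ly subrr.
- by rewrite !(morphDB LD) !LU /= betaDl -addrA -opprD subrr.
- by rewrite !(morphDB LD) !LU /= betaDr -addrA -opprD subrr.
Qed.

Let tens_lift_pi x : tens_lift (\pi_tensor x) = L x.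
Proof.
apply/eqP; rewrite -subr_eq0 -(morphDB LD); apply/eqP/L_rel.
have : \pi_tensor (repr (\pi_tensor x)) = \pi_tensor x by rewrite reprK.
by move/eqP; rewrite -(Quotient.idealrBE (GRing.ZmodClosed.clone _ tensor_relb _)) => /asboolP.
Qed.

Lemma tens_liftE a b : tens_lift (tens a b) = beta a b.
Proof. by rewrite tens_lift_pi LU. Qed.

Lemma tens_liftD : {morph tens_lift : x y / x + y}.
Proof.
move=> x y; rewrite -[x]reprK -[y]reprK -tensor_piD.
by rewrite !tens_lift_pi LD.
Qed.
End Lift.

End Tensor.

Section TensorScale.
Variables R R' : comPzRingType.
Local Notation T := (tensor R R').

Definition tlscale (r : R) : T -> T :=
  tens_lift (fun a b => tens (r * a) b).
Definition trscale (t : T) (s : R') : T :=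
  tens_lift (fun a b => tens a (b * s)) t.

Let lDl r (b : R') : {morph (fun a : R => tens (r * a) b) : x y / x + y}.
Proof. by move=> x y; rewrite mulrDr tensDl. Qed.
Let lDr r (a : R) : {morph (fun b : R' => tens (r * a) b) : x y / x + y}.
Proof. by move=> x y; rewrite tensDr. Qed.
Let rDl s (b : R') : {morph (fun a : R => tens a (b * s)) : x y / x + y}.
Proof. by move=> x y; rewrite tensDl. Qed.
Let rDr s (a : R) : {morph (fun b : R' => tens a (b * s)) : x y / x + y}.
Proof. by move=> x y; rewrite mulrDl tensDr. Qed.

Lemma tlscaleE r a b : tlscale r (tens a b) = tens (r * a) b.
Proof. by rewrite /tlscale tens_liftE. Qed.

Lemma trscaleE a b s : trscale (tens a b) s = tens a (b * s).
Proof. by rewrite /trscale tens_liftE. Qed.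

Lemma tlscaleDr r : {morph tlscale r : t u / t + u}.
Proof. by move=> t u; rewrite /tlscale tens_liftD. Qed.

Lemma trscaleDl s : {morph trscale^~ s : t u / t + u}.
Proof. by move=> t u; rewrite /trscale tens_liftD. Qed.

Lemma tlscaleDl t : {morph tlscale^~ t : r r' / r + r'}.
Proof.
move=> r r'; move: t; apply: tens_ext => [t u|t u|a b].
- exact: tlscaleDr.
- by rewrite !tlscaleDr addrACA.
- by rewrite !tlscaleE mulrDl tensDl.
Qed.

Lemma trscaleDr t : {morph trscale t : s s' / s + s'}.
Proof.
move=> s s'; move: t; apply: tens_ext => [t u|t u|a b].
- exact: trscaleDl.
- by rewrite !trscaleDl addrACA.
- by rewrite !trscaleE mulrDr tensDr.
Qed.

Lemma tlscaleA r r' t : tlscale r (tlscale r' t) = tlscale (r * r') t.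
Proof.
by move: t; apply: tens_ext => [t u|t u|a b];
  rewrite ?tlscaleDr ?tlscaleE ?mulrA.
Qed.

Lemma trscaleA t s s' : trscale (trscale t s) s' = trscale t (s * s').
Proof.
by move: t; apply: tens_ext => [t u|t u|a b];
  rewrite ?trscaleDl ?trscaleE ?mulrA.
Qed.

Lemma tlscale1 t : tlscale 1 t = t.
Proof.
by move: t; apply: tens_ext => [t u|t u|a b];
  rewrite ?tlscaleDr ?tlscaleE ?mul1r.
Qed.

Lemma trscale1 t : trscale t 1 = t.
Proof.
by move: t; apply: tens_ext => [t u|t u|a b];
  rewrite ?trscaleDl ?trscaleE ?mulr1.
Qed.

Lemma tlrscaleA r t s : trscale (tlscale r t) s = tlscale r (trscale t s).
Proof.
move: t; apply: tens_ext => [t u|t u|a b].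
- by rewrite tlscaleDr trscaleDl.
- by rewrite trscaleDl tlscaleDr.
- by rewrite tlscaleE !trscaleE tlscaleE.
Qed.
End TensorScale.
Arguments tlscale {R R'} r t.
Arguments trscale {R R'} t s.

Section Composition.
Variables (S : secat) (n : nat).

Lemma compoE (A B C : S) (g : hom B C n) (f : hom A B n) :
  compo (Simplex g) (Simplex f) = Some (Simplex (compn g f)).
Proof.
rewrite /compo; case: pselect => [e|/(_ erefl)//] /=.
by rewrite (Prop_irrelevance e erefl).
Qed.

Lemma compo_None (t s : simplices S n) : tgt s <> src t -> compo t s = None.
Proof. by rewrite /compo; case: pselect. Qed.

Lemma compo_ends (t s u : simplices S n) : compo t s = Some u ->
  src u = src s /\ tgt u = tgt t.
Proof. by rewrite /compo; case: pselect => // e [<-]. Qed.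

Lemma compoA (u t s : simplices S n) :
  obind (compo u) (compo t s) = obind (compo^~ s) (compo u t).
Proof.
have [ets|nts] := pselect (tgt s = src t); last first.
  rewrite (compo_None nts) /=; case ut: (compo u t) => [w|] //=.
  have [ew _] := compo_ends ut.
  by rewrite compo_None // ew.
have [eut|nut] := pselect (tgt t = src u); last first.
  rewrite (compo_None nut) /=; case st: (compo t s) => [w|] //=.
  have [_ ew] := compo_ends st.
  by rewrite compo_None // ew.
case: s u t ets eut => [A B s] [C D u] [B' C' t] /= e1 e2.
by subst; rewrite !compoE /= !compoE /compn compA.
Qed.
End Composition.

Lemma compn_face (S : secat) n (A B C : S) (j : 'I_n.+2)
    (g : hom B C n.+1) (f : hom A B n.+1) :
  face j (compn g f) = compn (face j g) (face j f).
Proof. by rewrite /compn -smap_face. Qed.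

Lemma compn_degs (S : secat) n (A B C : S) (g : hom B C 0) (f : hom A B 0) :
  degs n (compn g f) = compn (degs n g) (degs n f).
Proof. by elim: n => //= n ->; rewrite /compn -smap_deg. Qed.

Lemma face_degs (X : sset) n (j : 'I_n.+2) (x : X 0) :
  face j (degs n.+1 x) = degs n x.
Proof.
have lift_max m : lift ord0 (@ord_max m) = ord_max.
  by apply/val_inj; rewrite /= /bump.
elim: n j => [|n IHn] j; have := ltn_ord j; rewrite ltnS leq_eqVlt => /orP[].
- move/eqP=> j1; have -> : j = lift ord0 ord_max by exact/val_inj.
  by rewrite /= face_degS.
- rewrite ltnS leqn0 => /eqP j0; have -> : j = up ord_max by exact/val_inj.
  by rewrite /= face_deg.
- move/eqP=> jn; have -> : j = lift ord0 ord_max.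
    by rewrite lift_max; apply/val_inj.
  by rewrite -[degs n.+2 x]/(deg ord_max (degs n.+1 x)) face_degS.
rewrite ltnS leq_eqVlt => /orP[/eqP jn|lt_jn].
  have -> : j = up ord_max by exact/val_inj.
  by rewrite -[degs n.+2 x]/(deg ord_max (degs n.+1 x)) face_deg.
have lt_jn' : (j < n.+2)%N by apply: leq_trans lt_jn _.
have -> : j = up (Ordinal lt_jn') by exact/val_inj.
rewrite -[degs n.+2 x]/(deg ord_max (degs n.+1 x)) -lift_max face_deg_lt //.
by rewrite IHn.
Qed.

Lemma compo_degs (S : secat) n (g f : simplices S 0) :
  compo (degs_simplex n g) (degs_simplex n f) =
  omap (degs_simplex n) (compo g f).
Proof.
have [e|ne] := pselect (tgt f = src g); last by rewrite !compo_None.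
case: f g e => [A B f] [B' C g] /= e; subst B'.
by rewrite /degs_simplex compoE /= compoE compn_degs.
Qed.

Lemma compo_face (S : secat) n (j : 'I_n.+2) (t s : simplices S n.+1) :
  compo (face_simplex j t) (face_simplex j s) =
  omap (face_simplex j) (compo t s).
Proof.
have [e|ne] := pselect (tgt s = src t); last by rewrite !compo_None.
case: s t e => [A B s] [B' C t] /= e; subst B'.
by rewrite /face_simplex compoE /= compoE compn_face.
Qed.

Lemma face_simplex_degs (S : secat) n (j : 'I_n.+2) (f : simplices S 0) :
  face_simplex j (degs_simplex n.+1 f) = degs_simplex n f.
Proof.
case: f => A B f; rewrite /face_simplex.
by rewrite -[cell _]/(degs n.+1 f) face_degs.
Qed.

(* [R]-algebras, not necessarily unital. *)
Record algebra (R : comPzRingType) := Algebra {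
  alg_car :> lmodType R;
  amul : alg_car -> alg_car -> alg_car;
  amulA : associative amul;
  amulDl : left_distributive amul +%R;
  amulDr : right_distributive amul +%R;
  amulZl : forall (r : R) x y, amul (r *: x) y = r *: amul x y;
  amulZr : forall (r : R) x y, amul x (r *: y) = r *: amul x y
}.
Arguments amul {R A} x y : rename.

Record ring_bimodule (R R' : comPzRingType) := RingBimodule {
  rbim_car :> zmodType;
  lscale : R -> rbim_car -> rbim_car;
  rscale : rbim_car -> R' -> rbim_car;
  lscaleDl : forall m, {morph lscale^~ m : r r' / r + r'};
  lscaleDr : forall r, {morph lscale r : m m' / m + m'};
  lscaleA : forall r r' m, lscale r (lscale r' m) = lscale (r * r') m;
  lscale1 : forall m, lscale 1 m = m;
  rscaleDl : forall s, {morph rscale^~ s : m m' / m + m'};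
  rscaleDr : forall m, {morph rscale m : s s' / s + s'};
  rscaleA : forall m s s', rscale (rscale m s) s' = rscale m (s * s');
  rscale1 : forall m, rscale m 1 = m;
  lrscaleA : forall r m s, rscale (lscale r m) s = lscale r (rscale m s)
}.
Arguments lscale {R R' M} r m : rename.
Arguments rscale {R R' M} m s : rename.

Record bimodule (R R' : comPzRingType) (A : algebra R) (B : algebra R') :=
  Bimodule {
  bim_car :> ring_bimodule R R';
  lact : A -> bim_car -> bim_car;
  ract : bim_car -> B -> bim_car;
  lactDl : forall m, {morph lact^~ m : a a' / a + a'};
  lactDr : forall a, {morph lact a : m m' / m + m'};
  lactA : forall a a' m, lact a (lact a' m) = lact (amul a a') m;
  lactZl : forall r a m, lact (r *: a) m = lscale r (lact a m);
  lactZr : forall r a m, lact a (lscale r m) = lscale r (lact a m);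
  ractDl : forall b, {morph ract^~ b : m m' / m + m'};
  ractDr : forall m, {morph ract m : b b' / b + b'};
  ractA : forall m b b', ract (ract m b) b' = ract m (amul b b');
  ractZl : forall m b s, ract (rscale m s) b = rscale (ract m b) s;
  ractZr : forall m b s, ract m (s *: b) = rscale (ract m b) s;
  lractA : forall a m b, ract (lact a m) b = lact a (ract m b);
  lact_rscale : forall a m s, lact a (rscale m s) = rscale (lact a m) s;
  ract_lscale : forall r m b, ract (lscale r m) b = lscale r (ract m b)
}.
Arguments lact {R R' A B M} a m : rename.
Arguments ract {R R' A B M} m b : rename.

(* The category of bimodules over [R]-algebras on the left and [R']-algebras
   on the right; as the algebras have no unit, [bhom_act] does not split into
   two one-sided conditions. *)
Record bimod_obj (R R' : comPzRingType) := BimodObj {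
  left_alg : algebra R;
  right_alg : algebra R';
  bimod : bimodule left_alg right_alg
}.
Arguments BimodObj {R R' left_alg right_alg} bimod.

Record bimod_hom (R R' : comPzRingType) (X Y : bimod_obj R R') := BimodHom {
  bhoml : left_alg X -> left_alg Y;
  bhom : bimod X -> bimod Y;
  bhomr : right_alg X -> right_alg Y;
  bhoml_linear : linear bhoml;
  bhomlM : {morph bhoml : a a' / amul a a'};
  bhomD : {morph bhom : m m' / m + m'};
  bhomr_linear : linear bhomr;
  bhomrM : {morph bhomr : b b' / amul b b'};
  bhom_act : forall a m b,
    bhom (ract (lact a m) b) = ract (lact (bhoml a) (bhom m)) (bhomr b)
}.

Definition bimod_id (R R' : comPzRingType) (X : bimod_obj R R') :
  bimod_hom X X.
Proof. by refine (@BimodHom R R' X X id id id _ _ _ _ _ _). Defined.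

Definition bimod_comp (R R' : comPzRingType) (X Y Z : bimod_obj R R')
  (v : bimod_hom Y Z) (u : bimod_hom X Y) : bimod_hom X Z.
Proof.
refine (@BimodHom R R' X Z (bhoml v \o bhoml u) (bhom v \o bhom u)
  (bhomr v \o bhomr u) _ _ _ _ _ _) => /=.
- by move=> r a a' /=; rewrite !bhoml_linear.
- by move=> a a' /=; rewrite !bhomlM.
- by move=> m m' /=; rewrite !bhomD.
- by move=> s b b' /=; rewrite !bhomr_linear.
- by move=> b b' /=; rewrite !bhomrM.
- by move=> a m b; rewrite !bhom_act.
Defined.

Definition bimod_iso (R R' : comPzRingType) (X Y : bimod_obj R R') : Prop :=
  exists (u : bimod_hom X Y) (v : bimod_hom Y X),
    bimod_comp v u = bimod_id X /\ bimod_comp u v = bimod_id Y.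

(* The free [R]-module on [K]. *)
Definition freemod (R : comPzRingType) (K : choiceType) := {malg R[K]}.

Section FreeMod.
Variables (R : comPzRingType) (K : choiceType).
Local Notation F := (freemod R K).
HB.instance Definition _ := GRing.Zmodule.on F.

Definition fscale (r : R) (x : F) : F := mscale (fun c => r * c) x.

Let fscaleD r : {morph fscale r : x y / x + y}.
Proof. by apply: mscaleD => c d; rewrite mulrDr. Qed.
Let fscaleU r c k : fscale r << c *g k >> = << r * c *g k >>.
Proof. by apply: mscaleU => {}c d; rewrite mulrDr. Qed.
Let fscaleA r r' x : fscale r (fscale r' x) = fscale (r * r') x.
Proof.
move: x; apply: malg_ext => [x y|x y|k c].
- by rewrite !fscaleD.
- by rewrite !fscaleD.
- by rewrite !fscaleU mulrA.
Qed.
Let fscale1 : left_id 1 fscale.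
Proof.
apply: malg_ext => [x y|x y|k c] //; first exact: fscaleD.
by rewrite fscaleU mul1r.
Qed.
Let fscaleDl x : {morph fscale^~ x : r r' / r + r'}.
Proof.
move=> r r'; move: x; apply: malg_ext => [x y|x y|k c].
- by rewrite fscaleD.
- by rewrite !fscaleD addrACA.
- by rewrite !fscaleU mulrDl monalgUD.
Qed.

HB.instance Definition _ := GRing.Zmodule_isLmodule.Build R F
  fscaleA fscale1 fscaleD fscaleDl.

Lemma freemodZD (r : R) : {morph (fun x : F => r *: x) : x y / x + y}.
Proof. exact: fscaleD. Qed.
Lemma freemodZU (r : R) c k :
  r *: (<< c *g k >> : F) = << r * c *g k >> :> {malg R[K]}.
Proof. exact: fscaleU. Qed.
End FreeMod.

Section PathAlgebra.
Variables (R : comPzRingType) (S : secat).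
Local Notation P := (freemod R (simplices S 0)).

Definition path_mul (x y : P) : P := mprod (@compo S 0) *%R x y.

Let mulDl (d : R) : {morph *%R^~ d : x y / x + y}.
Proof. by move=> x y; rewrite mulrDl. Qed.
Let mulDr (d : R) : {morph *%R d : x y / x + y}.
Proof. by move=> x y; rewrite mulrDr. Qed.

Lemma path_mulDl : left_distributive path_mul +%R.
Proof. by move=> x y z; rewrite /path_mul mprodDl. Qed.

Lemma path_mulDr : right_distributive path_mul +%R.
Proof. by move=> x y z; rewrite /path_mul mprodDr. Qed.

Lemma path_mulUU (c d : R) f g : path_mul << c *g f >> << d *g g >> =
  if compo f g is Some h then << c * d *g h >> else 0.
Proof. by rewrite /path_mul mprodUU. Qed.

Lemma path_mulA : associative path_mul.
Proof.
by move=> x y z; apply: mprodA => //; [exact: mulrA | exact: compoA].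
Qed.

Lemma path_mulZl (r : R) x y : path_mul (r *: x) y = r *: path_mul x y.
Proof.
move: x; apply: malg_ext => [x x'|x x'|f c].
- by rewrite freemodZD path_mulDl.
- by rewrite path_mulDl freemodZD.
move: y; apply: malg_ext => [y y'|y y'|g d].
- by rewrite path_mulDr.
- by rewrite path_mulDr freemodZD.
rewrite freemodZU !path_mulUU; case: compo => [h|]; last by rewrite scaler0.
by rewrite freemodZU mulrA.
Qed.

Lemma path_mulZr (r : R) x y : path_mul x (r *: y) = r *: path_mul x y.
Proof.
move: x; apply: malg_ext => [x x'|x x'|f c].
- by rewrite path_mulDl.
- by rewrite path_mulDl freemodZD.
move: y; apply: malg_ext => [y y'|y y'|g d].
- by rewrite freemodZD path_mulDr.
- by rewrite path_mulDr freemodZD.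
rewrite freemodZU !path_mulUU; case: compo => [h|]; last by rewrite scaler0.
by rewrite freemodZU mulrCA.
Qed.

Definition path_algebra : algebra R :=
  Algebra path_mulA path_mulDl path_mulDr path_mulZl path_mulZr.
End PathAlgebra.

(* Bimodule homomorphisms over fixed coefficients. *)
Record bimodule_map (R R' : comPzRingType) (A : algebra R) (B : algebra R')
    (M N : bimodule A B) := BimoduleMap {
  bmap :> M -> N;
  bmapD : {morph bmap : m m' / m + m'};
  bmap_lscale : forall r m, bmap (lscale r m) = lscale r (bmap m);
  bmap_rscale : forall m s, bmap (rscale m s) = rscale (bmap m) s;
  bmap_lact : forall a m, bmap (lact a m) = lact a (bmap m);
  bmap_ract : forall m b, bmap (ract m b) = ract (bmap m) b
}.

Section Homology.
Variables (R R' : comPzRingType) (A : algebra R) (B : algebra R').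
Variables (L M N : bimodule A B) (d1 : bimodule_map L M).
Variables (d0 : bimodule_map M N).

Definition cycle_pred (c : M) : bool := d0 c == 0.

Lemma cycle_pred_zmod : zmod_closed cycle_pred.
Proof.
split=> [|x y /eqP dx /eqP dy]; rewrite unfold_in /cycle_pred.
- by rewrite (morphD0 (@bmapD _ _ _ _ _ _ d0)).
- by rewrite (morphDB (@bmapD _ _ _ _ _ _ d0)) dx dy subrr.
Qed.

HB.instance Definition _ :=
  GRing.isZmodClosed.Build M cycle_pred cycle_pred_zmod.

Definition cycles := {c : M | cycle_pred c}.
HB.instance Definition _ := SubChoice.on cycles.
HB.instance Definition _ := [SubChoice_isSubZmodule of cycles by <:].

Definition cycv (z : cycles) : M := \val z.
Definition in_cycles (c : M) : cycles := insubd 0 c.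

Lemma cycv_inj : injective cycv. Proof. exact: val_inj. Qed.

Lemma cycv0 : cycv 0 = 0. Proof. exact: raddf0. Qed.

Lemma cycvD : {morph cycv : x y / x + y}. Proof. exact: raddfD. Qed.

Lemma cycvB : {morph cycv : x y / x - y}. Proof. exact: raddfB. Qed.

Lemma cycleP z : d0 (cycv z) = 0.
Proof. by apply/eqP; exact: (valP z). Qed.

Lemma cycv_in c : d0 c = 0 -> cycv (in_cycles c) = c.
Proof.
by move=> dc; rewrite /cycv insubdK // unfold_in /cycle_pred dc eqxx.
Qed.

Definition boundary_pred (z : cycles) : bool := `[< exists c, d1 c = cycv z >].

Lemma boundary_pred_zmod : zmod_closed boundary_pred.
Proof.
split=> [|x y /asboolP[c dc] /asboolP[c' dc']]; apply/asboolP.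
- by exists 0; rewrite (morphD0 (@bmapD _ _ _ _ _ _ d1)) cycv0.
- by exists (c - c'); rewrite (morphDB (@bmapD _ _ _ _ _ _ d1)) dc dc' cycvB.
Qed.

HB.instance Definition _ :=
  GRing.isZmodClosed.Build cycles boundary_pred boundary_pred_zmod.

(* [ker d0 / im d1] *)
Definition homology :=
  Quotient.quot (GRing.ZmodClosed.clone cycles boundary_pred _).
HB.instance Definition _ := GRing.Zmodule.on homology.

Definition hclass (z : cycles) : homology := \pi z.

Lemma hclass_ind (P : homology -> Prop) :
  (forall z, P (hclass z)) -> forall h, P h.
Proof. by move=> Pz h; rewrite -[h]reprK; apply: Pz. Qed.

Lemma hclassD : {morph hclass : x y / x + y}.
Proof. exact: Quotient.pi_add. Qed.

Lemma hclass_eq x y :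
  hclass x = hclass y <-> exists c, d1 c = cycv x - cycv y.
Proof.
rewrite -cycvB; split=> [/eqP|xy].
  rewrite -(Quotient.idealrBE (GRing.ZmodClosed.clone _ boundary_pred _)).
  by move/asboolP.
apply/eqP.
rewrite -(Quotient.idealrBE (GRing.ZmodClosed.clone _ boundary_pred _)).
exact/asboolP.
Qed.

(* The endomorphism of homology induced by an additive [phi] stabilizing both
   cycles and boundaries: the class of [z] goes to the class of [phi z]. *)
Definition hmap (phi : M -> M) (h : homology) : homology :=
  hclass (in_cycles (phi (cycv (repr h)))).

Definition stabilizes (phi : M -> M) : Prop :=
  [/\ {morph phi : x y / x + y}, forall c, d0 c = 0 -> d0 (phi c) = 0
    & forall c, exists c', d1 c' = phi (d1 c)].

Lemma hmapE phi z : stabilizes phi ->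
  hmap phi (hclass z) = hclass (in_cycles (phi (cycv z))).
Proof.
case=> phiD phi0 phi1; apply/hclass_eq.
rewrite !cycv_in ?phi0 ?cycleP // -(morphDB phiD).
have /hclass_eq[c <-] : hclass (repr (hclass z)) = hclass z by apply: reprK.
exact: phi1.
Qed.

Lemma hmapD phi : stabilizes phi -> {morph hmap phi : x y / x + y}.
Proof.
move=> st; case: (st) => phiD phi0 _.
elim/hclass_ind=> x; elim/hclass_ind=> y; rewrite -hclassD !hmapE // -hclassD.
congr hclass; apply/cycv_inj.
by rewrite [RHS]cycvD !cycv_in ?phi0 ?cycleP // cycvD phiD.
Qed.

Lemma hmap_add phi psi chi : stabilizes phi -> stabilizes psi ->
  stabilizes chi -> (forall m, chi m = phi m + psi m) ->
  forall h, hmap chi h = hmap phi h + hmap psi h.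
Proof.
move=> s1 s2 s3 e; elim/hclass_ind=> z; rewrite !hmapE // -hclassD.
case: s1 s2 s3 => [_ p1 _] [_ p2 _] [_ p3 _].
congr hclass; apply/cycv_inj.
by rewrite cycvD !cycv_in ?p1 ?p2 ?p3 ?cycleP.
Qed.

Lemma hmap_comp phi psi chi : stabilizes phi -> stabilizes psi ->
  stabilizes chi -> (forall m, phi (psi m) = chi m) ->
  forall h, hmap phi (hmap psi h) = hmap chi h.
Proof.
move=> s1 s2 s3 e; elim/hclass_ind=> z; rewrite !hmapE //.
case: s1 s2 s3 => [_ p1 _] [_ p2 _] [_ p3 _].
congr hclass; apply/cycv_inj.
by rewrite !cycv_in ?p1 ?p2 ?p3 ?cycleP // ?p2 ?cycleP.
Qed.

Lemma hmap_id phi : stabilizes phi -> phi =1 id -> hmap phi =1 id.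
Proof.
move=> s e; elim/hclass_ind=> z; rewrite hmapE //; congr hclass.
by apply/cycv_inj; rewrite cycv_in e ?cycleP.
Qed.

Let st_l r : stabilizes (lscale r).
Proof.
split=> [|c dc|c]; first exact: lscaleDr.
- by rewrite bmap_lscale dc (morphD0 (lscaleDr r)).
- by exists (lscale r c); rewrite bmap_lscale.
Qed.

Let st_r s : stabilizes (rscale^~ s).
Proof.
split=> [|c dc|c]; first exact: rscaleDl.
- by rewrite bmap_rscale dc (morphD0 (rscaleDl s)).
- by exists (rscale c s); rewrite bmap_rscale.
Qed.

Let st_la a : stabilizes (lact a).
Proof.
split=> [|c dc|c]; first exact: lactDr.
- by rewrite bmap_lact dc (morphD0 (lactDr a)).
- by exists (lact a c); rewrite bmap_lact.
Qed.

Let st_ra b : stabilizes (ract^~ b).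
Proof.
split=> [|c dc|c]; first exact: ractDl.
- by rewrite bmap_ract dc (morphD0 (ractDl b)).
- by exists (ract c b); rewrite bmap_ract.
Qed.

Let st_comp phi psi : stabilizes phi -> stabilizes psi ->
  stabilizes (phi \o psi).
Proof.
move=> [pD p0 p1] [qD q0 q1]; split=> [x y|c dc|c] /=; first by rewrite qD pD.
- by rewrite p0 ?q0.
- by have [c' <-] := q1 c; exact: p1.
Qed.

Let comm phi psi phi' psi' : stabilizes phi -> stabilizes psi ->
  stabilizes phi' -> stabilizes psi' ->
  (forall m, phi (psi m) = phi' (psi' m)) ->
  forall h, hmap phi (hmap psi h) = hmap phi' (hmap psi' h).
Proof.
move=> s1 s2 s3 s4 e h.
rewrite (hmap_comp s1 s2 (st_comp s3 s4)) //.
by rewrite -(hmap_comp s3 s4 (st_comp s3 s4)).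
Qed.

Definition homology_ring_bimodule : ring_bimodule R R'.
Proof.
refine (@RingBimodule R R' homology (fun r => hmap (lscale r))
  (fun h s => hmap (rscale^~ s) h) _ _ _ _ _ _ _ _ _).
- by move=> h r r'; apply: hmap_add => // m; exact: lscaleDl.
- by move=> r; exact: hmapD.
- by move=> r r' h; apply: hmap_comp => // m; exact: lscaleA.
- by apply: hmap_id => // m; exact: lscale1.
- by move=> s; exact: hmapD.
- by move=> h s s'; apply: hmap_add => // m; exact: rscaleDr.
- by move=> h s s'; apply: (hmap_comp (st_r _)) => // m; exact: rscaleA.
- by apply: hmap_id => // m; exact: rscale1.
- by move=> r h s; apply: (comm (st_r _)) => // m; exact: lrscaleA.
Defined.

Definition homology_bimodule : bimodule A B.
Proof.
refine (@Bimodule R R' A B homology_ring_bimodule (fun a => hmap (lact a))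
  (fun h b => hmap (ract^~ b) h) _ _ _ _ _ _ _ _ _ _ _ _ _).
- by move=> h a a'; apply: hmap_add => // m; exact: lactDl.
- by move=> a; exact: hmapD.
- by move=> a a' h; apply: hmap_comp => // m; exact: lactA.
- move=> r a h; apply/esym.
  by apply: (hmap_comp (st_l _)) => // m; rewrite lactZl.
- by move=> r a h; apply: (comm (st_la _)) => // m; exact: lactZr.
- by move=> b; exact: hmapD.
- by move=> h b b'; apply: hmap_add => // m; exact: ractDr.
- by move=> h b b'; apply: (hmap_comp (st_ra _)) => // m; exact: ractA.
- by move=> h b s; apply: (comm (st_ra _)) => // m; exact: ractZl.
- move=> h b s; apply/esym.
  by apply: (hmap_comp (st_r _)) => // m; rewrite ractZr.
- by move=> a h b; apply: (comm (st_ra _)) => // m; exact: lractA.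
- by move=> a h s; apply: (comm (st_la _)) => // m; exact: lact_rscale.
- by move=> r h b; apply: (comm (st_ra _)) => // m; exact: ract_lscale.
Defined.
End Homology.

Section Chains.
Variables (R R' : comPzRingType) (S : secat).
Local Notation T := (tensor R R').

(* The direct sum of copies of [T] indexed by the [n]-simplices. *)
Definition chain (n : nat) := {malg T[simplices S n]}.

Section Action.
Variable n : nat.
Implicit Types (c : chain n).

Definition chain_lscale (r : R) c : chain n := mscale (tlscale r) c.
Definition chain_rscale c (s : R') : chain n := mscale (trscale^~ s) c.

(* On generators, [f.sigma] is the composite of the degenerate [f] after
   [sigma] (or [0]); so [(f.sigma).g] is the composite of the three when they
   are composable and [0] otherwise. *)
Definition chain_lact (a : path_algebra R S) c : chain n :=
  mprod (fun f s => compo (degs_simplex n f) s) tlscale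
    (a : {malg R[simplices S 0]}) c.
Definition chain_ract c (b : path_algebra R' S) : chain n :=
  mprod (fun s g => compo s (degs_simplex n g)) trscale
    c (b : {malg R'[simplices S 0]}).

Lemma chain_lscaleDr r : {morph chain_lscale r : c c' / c + c'}.
Proof. exact/mscaleD/tlscaleDr. Qed.

Lemma chain_rscaleDl s : {morph chain_rscale^~ s : c c' / c + c'}.
Proof. exact/mscaleD/trscaleDl. Qed.

Lemma chain_lscaleU r t s :
  chain_lscale r << t *g s >> = << tlscale r t *g s >>.
Proof. exact/mscaleU/tlscaleDr. Qed.

Lemma chain_rscaleU r t s :
  chain_rscale << t *g s >> r = << trscale t r *g s >>.
Proof. exact/mscaleU/trscaleDl. Qed.

Lemma chain_lactDl c : {morph chain_lact^~ c : a a' / a + a'}.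
Proof.
by move=> a a'; apply: mprodDl => t; exact: tlscaleDl.
Qed.

Lemma chain_lactDr a : {morph chain_lact a : c c' / c + c'}.
Proof.
by move=> c c'; apply: mprodDr => r; exact: tlscaleDr.
Qed.

Lemma chain_ractDl b : {morph chain_ract^~ b : c c' / c + c'}.
Proof.
by move=> c c'; apply: mprodDl => r; exact: trscaleDl.
Qed.

Lemma chain_ractDr c : {morph chain_ract c : b b' / b + b'}.
Proof. by move=> b b'; apply: mprodDr => t; exact: trscaleDr. Qed.

Lemma chain_lactUU r f t s :
  chain_lact << r *g f >> << t *g s >> =
  if compo (degs_simplex n f) s is Some u then << tlscale r t *g u >> else 0.
Proof. by apply: mprodUU => [u|q]; [exact: tlscaleDl|exact: tlscaleDr]. Qed.

Lemma chain_ractUU t s r g :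
  chain_ract << t *g s >> << r *g g >> =
  if compo s (degs_simplex n g) is Some u then << trscale t r *g u >> else 0.
Proof. by apply: mprodUU => [q|u]; [exact: trscaleDl|exact: trscaleDr]. Qed.

Definition chain_ring_bimodule : ring_bimodule R R'.
Proof.
refine (@RingBimodule R R' (chain n) chain_lscale chain_rscale
  _ chain_lscaleDr _ _ chain_rscaleDl _ _ _ _).
- move=> c r r'; move: c; apply: malg_ext => [x y|x y|s t].
  + exact: chain_lscaleDr.
  + by rewrite !chain_lscaleDr; exact: addrACA.
  + by rewrite !chain_lscaleU tlscaleDl monalgUD.
- move=> r r'; apply: malg_ext => [x y|x y|s t].
  + by rewrite !chain_lscaleDr.
  + exact: chain_lscaleDr.
  + by rewrite !chain_lscaleU tlscaleA.
- apply: malg_ext => [x y|x y|s t] //; first exact: chain_lscaleDr.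
  by rewrite chain_lscaleU tlscale1.
- move=> c r r'; move: c; apply: malg_ext => [x y|x y|s t].
  + exact: chain_rscaleDl.
  + by rewrite !chain_rscaleDl; exact: addrACA.
  + by rewrite !chain_rscaleU trscaleDr monalgUD.
- move=> c r r'; move: c; apply: malg_ext => [x y|x y|s t].
  + by rewrite !chain_rscaleDl.
  + exact: chain_rscaleDl.
  + by rewrite !chain_rscaleU trscaleA.
- apply: malg_ext => [x y|x y|s t] //; first exact: chain_rscaleDl.
  by rewrite chain_rscaleU trscale1.
- move=> r c q; move: c; apply: malg_ext => [x y|x y|s t].
  + by rewrite chain_lscaleDr chain_rscaleDl.
  + by rewrite chain_rscaleDl chain_lscaleDr.
  + by rewrite chain_lscaleU !chain_rscaleU chain_lscaleU tlrscaleA.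
Defined.

Lemma chain_lact_ext (phi psi : path_algebra R S -> chain n -> chain n) :
  (forall c, {morph phi^~ c : a a' / a + a'}) ->
  (forall a, {morph phi a : c c' / c + c'}) ->
  (forall c, {morph psi^~ c : a a' / a + a'}) ->
  (forall a, {morph psi a : c c' / c + c'}) ->
  (forall r f t s, phi << r *g f >> << t *g s >> =
                   psi << r *g f >> << t *g s >>) ->
  forall a c, phi a c = psi a c.
Proof.
move=> D1 D2 D3 D4 e a c; move: a.
apply: (@malg_ext _ _ _ (phi^~ c) (psi^~ c)) => [||f r] //.
by move: c; apply: malg_ext.
Qed.

Lemma chain_ract_ext (phi psi : chain n -> path_algebra R' S -> chain n) :
  (forall b, {morph phi^~ b : c c' / c + c'}) ->
  (forall c, {morph phi c : b b' / b + b'}) ->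
  (forall b, {morph psi^~ b : c c' / c + c'}) ->
  (forall c, {morph psi c : b b' / b + b'}) ->
  (forall t s r g, phi << t *g s >> << r *g g >> =
                   psi << t *g s >> << r *g g >>) ->
  forall c b, phi c b = psi c b.
Proof.
move=> D1 D2 D3 D4 e c b; move: c.
apply: (@malg_ext _ _ _ (phi^~ b) (psi^~ b)) => [||s t] //.
by move: b; apply: malg_ext.
Qed.

Lemma chain_lactA a a' c :
  chain_lact a (chain_lact a' c) = chain_lact (amul a a') c.
Proof.
rewrite /chain_lact /= /path_mul.
refine (mprodA (op12 := compo) _ _ _ _ _ _ _ _ _ _ a a' c).
- by move=> d x y; rewrite mulrDl.
- by move=> d x y; rewrite mulrDr.
- exact: tlscaleDl.
- exact: tlscaleDr.
- exact: tlscaleDl.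
- exact: tlscaleDr.
- exact: tlscaleDl.
- exact: tlscaleDr.
- exact: tlscaleA.
- by move=> k l m; rewrite compoA compo_degs; case: (compo k l).
Qed.

Lemma chain_ractA c b b' :
  chain_ract (chain_ract c b) b' = chain_ract c (amul b b').
Proof.
rewrite /chain_ract /= /path_mul; apply/esym.
refine (mprodA (op23 := compo) _ _ _ _ _ _ _ _ _ _ c b b').
- exact: trscaleDl.
- exact: trscaleDr.
- by move=> d x y; rewrite mulrDl.
- by move=> d x y; rewrite mulrDr.
- exact: trscaleDl.
- exact: trscaleDr.
- exact: trscaleDl.
- exact: trscaleDr.
- by move=> t q r; rewrite trscaleA.
- by move=> k l m; rewrite -compoA compo_degs; case: (compo l m).
Qed.

Lemma chain_lractA a c b :
  chain_ract (chain_lact a c) b = chain_lact a (chain_ract c b).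
Proof.
apply/esym; refine (mprodA _ _ _ _ _ _ _ _ _ _ a c b).
- exact: tlscaleDl.
- exact: tlscaleDr.
- exact: trscaleDl.
- exact: trscaleDr.
- exact: trscaleDl.
- exact: trscaleDr.
- exact: tlscaleDl.
- exact: tlscaleDr.
- by move=> r t q; rewrite tlrscaleA.
- by move=> f s g; exact: compoA.
Qed.

Lemma chain_lscale0 r : chain_lscale r 0 = 0.
Proof. exact: morphD0 (chain_lscaleDr r). Qed.

Lemma chain_rscale0 s : chain_rscale 0 s = 0.
Proof. exact: morphD0 (chain_rscaleDl s). Qed.

Lemma chain_lactZl r a c :
  chain_lact (r *: a) c = chain_lscale r (chain_lact a c).
Proof.
pose phi a c := chain_lact (r *: a) c.
pose psi a c := chain_lscale r (chain_lact a c).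
apply: (@chain_lact_ext phi psi) => [d|d|d|d|q f t s]; rewrite /phi /psi.
- by move=> x y; rewrite scalerDr chain_lactDl.
- by move=> x y; rewrite chain_lactDr.
- by move=> x y; rewrite chain_lactDl chain_lscaleDr.
- by move=> x y; rewrite chain_lactDr chain_lscaleDr.
rewrite freemodZU !chain_lactUU.
case: compo => [u|]; last by rewrite chain_lscale0.
by rewrite chain_lscaleU tlscaleA.
Qed.

Lemma chain_lactZr r a c :
  chain_lact a (chain_lscale r c) = chain_lscale r (chain_lact a c).
Proof.
pose phi a c := chain_lact a (chain_lscale r c).
pose psi a c := chain_lscale r (chain_lact a c).
apply: (@chain_lact_ext phi psi) => [d|d|d|d|q f t s]; rewrite /phi /psi.
- by move=> x y; rewrite chain_lactDl.
- by move=> x y; rewrite chain_lscaleDr chain_lactDr.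
- by move=> x y; rewrite chain_lactDl chain_lscaleDr.
- by move=> x y; rewrite chain_lactDr chain_lscaleDr.
rewrite chain_lscaleU !chain_lactUU.
case: compo => [u|]; last by rewrite chain_lscale0.
by rewrite chain_lscaleU !tlscaleA mulrC.
Qed.

Lemma chain_lact_rscale a c r :
  chain_lact a (chain_rscale c r) = chain_rscale (chain_lact a c) r.
Proof.
pose phi a c := chain_lact a (chain_rscale c r).
pose psi a c := chain_rscale (chain_lact a c) r.
apply: (@chain_lact_ext phi psi) => [d|d|d|d|q f t s]; rewrite /phi /psi.
- by move=> x y; rewrite chain_lactDl.
- by move=> x y; rewrite chain_rscaleDl chain_lactDr.
- by move=> x y; rewrite chain_lactDl chain_rscaleDl.
- by move=> x y; rewrite chain_lactDr chain_rscaleDl.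
rewrite chain_rscaleU !chain_lactUU.
case: compo => [u|]; last by rewrite chain_rscale0.
by rewrite chain_rscaleU tlrscaleA.
Qed.

Lemma chain_ractZl c b r :
  chain_ract (chain_rscale c r) b = chain_rscale (chain_ract c b) r.
Proof.
pose phi c b := chain_ract (chain_rscale c r) b.
pose psi c b := chain_rscale (chain_ract c b) r.
apply: (@chain_ract_ext phi psi) => [d|d|d|d|t s q g]; rewrite /phi /psi.
- by move=> x y; rewrite chain_rscaleDl chain_ractDl.
- by move=> x y; rewrite chain_ractDr.
- by move=> x y; rewrite chain_ractDl chain_rscaleDl.
- by move=> x y; rewrite chain_ractDr chain_rscaleDl.
rewrite chain_rscaleU !chain_ractUU.
case: compo => [u|]; last by rewrite chain_rscale0.
by rewrite chain_rscaleU !trscaleA mulrC.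
Qed.

Lemma chain_ractZr c b (r : R') :
  chain_ract c (r *: b) = chain_rscale (chain_ract c b) r.
Proof.
pose phi c b := chain_ract c (r *: b).
pose psi c b := chain_rscale (chain_ract c b) r.
apply: (@chain_ract_ext phi psi) => [d|d|d|d|t s q g]; rewrite /phi /psi.
- by move=> x y; rewrite chain_ractDl.
- by move=> x y; rewrite scalerDr chain_ractDr.
- by move=> x y; rewrite chain_ractDl chain_rscaleDl.
- by move=> x y; rewrite chain_ractDr chain_rscaleDl.
rewrite freemodZU !chain_ractUU.
case: compo => [u|]; last by rewrite chain_rscale0.
by rewrite chain_rscaleU trscaleA mulrC.
Qed.

Lemma chain_ract_lscale r c b :
  chain_ract (chain_lscale r c) b = chain_lscale r (chain_ract c b).
Proof.
pose phi c b := chain_ract (chain_lscale r c) b.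
pose psi c b := chain_lscale r (chain_ract c b).
apply: (@chain_ract_ext phi psi) => [d|d|d|d|t s q g]; rewrite /phi /psi.
- by move=> x y; rewrite chain_lscaleDr chain_ractDl.
- by move=> x y; rewrite chain_ractDr.
- by move=> x y; rewrite chain_ractDl chain_lscaleDr.
- by move=> x y; rewrite chain_ractDr chain_lscaleDr.
rewrite chain_lscaleU !chain_ractUU.
case: compo => [u|]; last by rewrite chain_lscale0.
by rewrite chain_lscaleU tlrscaleA.
Qed.

Lemma chain_act_gen (X Y A B : S) (f : hom B Y 0) (s : hom A B n)
    (g : hom X A 0) t :
  chain_ract (chain_lact << Simplex f >> << t *g Simplex s >>)
    << Simplex g >> =
  << t *g Simplex (compn (compn (degs n f) s) (degs n g)) >>.
Proof.
by rewrite chain_lactUU compoE chain_ractUU compoE tlscale1 trscale1.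
Qed.

Lemma chain_act_gen0 (f g : simplices S 0) (s : simplices S n) t :
  tgt s <> src f \/ tgt g <> src s ->
  chain_ract (chain_lact << f >> << t *g s >>) << g >> = 0.
Proof.
have lact0 a : chain_lact a 0 = 0 := morphD0 (chain_lactDr a).
have ract0 b : chain_ract 0 b = 0 := morphD0 (chain_ractDl b).
case=> [ne|ne]; last rewrite chain_lractA.
- by rewrite chain_lactUU compo_None // ract0.
- by rewrite chain_ractUU compo_None // lact0.
Qed.

Definition chain_bimodule :
  bimodule (path_algebra R S) (path_algebra R' S) :=
  @Bimodule R R' (path_algebra R S) (path_algebra R' S) chain_ring_bimodule
    chain_lact chain_ract
    chain_lactDl chain_lactDr chain_lactA chain_lactZl chain_lactZr
    chain_ractDl chain_ractDr chain_ractA chain_ractZl chain_ractZr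
    chain_lractA chain_lact_rscale chain_ract_lscale.
End Action.

Definition boundary_fun (n : nat) : chain n.+1 -> chain n :=
  mlift (fun (s : simplices S n.+1) t =>
    \sum_(j < n.+2) << t *g face_simplex j s >> *~ (-1) ^+ j).

Section Boundary.
Variable n : nat.
Implicit Types (c : chain n.+1).

Let bD s : {morph (fun t : T => \sum_(j < n.+2)
  << t *g face_simplex j s >> *~ (-1) ^+ j : chain n) : t u / t + u}.
Proof.
move=> t u; rewrite -big_split /=; apply: eq_bigr => j _.
by rewrite monalgUD mulrzDl.
Qed.

Lemma boundary_funD : {morph @boundary_fun n : c c' / c + c'}.
Proof. exact: mliftD. Qed.

Lemma boundary_funU t s : boundary_fun << t *g s >> =
  \sum_(j < n.+2) << t *g face_simplex j s >> *~ (-1) ^+ j :> chain n.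
Proof. exact: mliftU. Qed.

Lemma boundary_fun_lscale r c :
  boundary_fun (chain_lscale r c) = chain_lscale r (boundary_fun c).
Proof.
move: c; apply: malg_ext => [x y|x y|s t].
- by rewrite chain_lscaleDr boundary_funD.
- by rewrite boundary_funD chain_lscaleDr.
rewrite chain_lscaleU !boundary_funU.
rewrite (big_morph _ (chain_lscaleDr r) (chain_lscale0 n r)).
apply: eq_bigr => j _.
by rewrite (morphDMz (chain_lscaleDr r)) chain_lscaleU.
Qed.

Lemma boundary_fun_rscale c r :
  boundary_fun (chain_rscale c r) = chain_rscale (boundary_fun c) r.
Proof.
move: c; apply: malg_ext => [x y|x y|s t].
- by rewrite chain_rscaleDl boundary_funD.
- by rewrite boundary_funD chain_rscaleDl.
rewrite chain_rscaleU !boundary_funU.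
rewrite (big_morph _ (chain_rscaleDl r) (chain_rscale0 n r)).
apply: eq_bigr => j _.
by rewrite (morphDMz (chain_rscaleDl r)) chain_rscaleU.
Qed.

Lemma boundary_fun0 : boundary_fun (0 : chain n.+1) = 0 :> chain n.
Proof. exact: morphD0 boundary_funD. Qed.

Lemma boundary_fun_lact a c :
  boundary_fun (chain_lact a c) = chain_lact a (boundary_fun c).
Proof.
move: a; apply: (@malg_ext _ _ _ (fun a => boundary_fun (chain_lact a c))
    (fun a => chain_lact a (boundary_fun c))) => [x y|x y|f r].
- by rewrite chain_lactDl boundary_funD.
- by rewrite chain_lactDl.
move: c; apply: malg_ext => [x y|x y|s t].
- by rewrite chain_lactDr boundary_funD.
- by rewrite boundary_funD chain_lactDr.
rewrite boundary_funU (big_morph _ (chain_lactDr _)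
  (morphD0 (chain_lactDr << r *g f >>))).
rewrite chain_lactUU; case fs: compo => [u|]; last first.
  rewrite boundary_fun0; apply/esym/big1 => j _.
  rewrite (morphDMz (chain_lactDr << r *g f >>)) chain_lactUU.
  by rewrite -(face_simplex_degs j) compo_face fs mul0rz.
rewrite boundary_funU; apply: eq_bigr => j _.
rewrite (morphDMz (chain_lactDr << r *g f >>)) chain_lactUU.
by rewrite -(face_simplex_degs j) compo_face fs.
Qed.

Lemma boundary_fun_ract c b :
  boundary_fun (chain_ract c b) = chain_ract (boundary_fun c) b.
Proof.
move: b; apply: (@malg_ext _ _ _ (fun b => boundary_fun (chain_ract c b))
    (fun b => chain_ract (boundary_fun c) b)) => [x y|x y|g r].
- by rewrite chain_ractDr boundary_funD.
- by rewrite chain_ractDr.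
move: c; apply: malg_ext => [x y|x y|s t].
- by rewrite chain_ractDl boundary_funD.
- by rewrite boundary_funD chain_ractDl.
rewrite boundary_funU (big_morph _ (chain_ractDl _)
  (morphD0 (chain_ractDl << r *g g >>))).
rewrite chain_ractUU; case sg: compo => [u|]; last first.
  rewrite boundary_fun0; apply/esym/big1 => j _.
  rewrite (morphDMz (chain_ractDl << r *g g >>)) chain_ractUU.
  by rewrite -(face_simplex_degs j) compo_face sg mul0rz.
rewrite boundary_funU; apply: eq_bigr => j _.
rewrite (morphDMz (chain_ractDl << r *g g >>)) chain_ractUU.
by rewrite -(face_simplex_degs j) compo_face sg.
Qed.
End Boundary.

Lemma boundary_fun_boundary n (c : chain n.+2) :
  boundary_fun (boundary_fun c) = 0.
Proof.
move: c; apply: (@malg_ext _ _ _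
    (fun c => boundary_fun (boundary_fun c)) (fun=> 0)) => [x y|x y|s t].
- by rewrite !boundary_funD.
- by rewrite addr0.
rewrite boundary_funU (big_morph _ (@boundary_funD n) (boundary_fun0 n)).
pose F (i : 'I_n.+2) (j : 'I_n.+3) : chain n :=
  << t *g face_simplex i (face_simplex j s) >> *~ (-1) ^+ (i + j).
transitivity (\sum_(i < n.+2) \sum_(j < n.+3) F i j).
  rewrite exchange_big; apply: eq_bigr => j _ /=.
  rewrite (morphDMz (@boundary_funD n)) boundary_funU mulrz_suml.
  by apply: eq_bigr => i _; rewrite /F exprD mulrzA.
transitivity (\sum_(i < n.+2) (\sum_(k < n.+2 | (i <= k)%N) F i (lift ord0 k) +
    \sum_(k < n.+2 | (k <= i)%N) F i (up k))).
  apply: eq_bigr => i _; rewrite (bigID (fun j : 'I_n.+3 => (i < j)%N)) /=.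
  congr (_ + _).
    rewrite big_mkcond big_ord_recl /= add0r [RHS]big_mkcond /=.
    by apply: eq_bigr => k _; rewrite /bump.
  rewrite big_mkcond big_ord_recr /= ltn_ord addr0 [RHS]big_mkcond /=.
  by apply: eq_bigr => k _; rewrite -leqNgt.
have swap : \sum_(i < n.+2) \sum_(k < n.+2 | (k <= i)%N) F i (up k) =
    \sum_(k < n.+2) \sum_(i < n.+2 | (k <= i)%N) F i (up k).
  by rewrite (exchange_big_dep predT).
have neg : \sum_(i < n.+2) \sum_(k < n.+2 | (i <= k)%N) F i (lift ord0 k) =
    - \sum_(k < n.+2) \sum_(i < n.+2 | (k <= i)%N) F i (up k).
  rewrite -sumrN; apply: eq_bigr => k _.
  rewrite -sumrN; apply: eq_bigr => i le_ki.
  have dd : face_simplex k (face_simplex (lift ord0 i) s) =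
      face_simplex i (face_simplex (up k) s).
    by case: s {F swap} => A B s; rewrite /face_simplex /= face_face.
  by rewrite /F dd /= /bump /= add1n addnS exprS mulN1r mulrNz addnC.
refine (etrans (big_split _ _ _ _ _) _).
refine (etrans (congr2 +%R neg swap) _); exact: addNr.
Qed.

(* [d_n : C_n -> C_{n-1}], where [d_0 = 0]; at [n = 0] the target is [C_0]. *)
Definition boundary (n : nat) :
  bimodule_map (chain_bimodule n) (chain_bimodule n.-1).
Proof.
case: n => [|n].
- refine (@BimoduleMap R R' _ _ (chain_bimodule 0) (chain_bimodule 0)
    (fun=> 0) _ _ _ _ _).
  + by move=> x y; rewrite addr0.
  + by move=> r m; rewrite (morphD0 (lscaleDr r)).
  + by move=> m s; rewrite (morphD0 (rscaleDl s)).
  + by move=> a m; rewrite (morphD0 (lactDr a)).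
  + by move=> m b; rewrite (morphD0 (ractDl b)).
- exact: (@BimoduleMap R R' _ _ (chain_bimodule n.+1) (chain_bimodule n)
    (@boundary_fun n) (@boundary_funD n) (@boundary_fun_lscale n)
    (@boundary_fun_rscale n) (@boundary_fun_lact n) (@boundary_fun_ract n)).
Defined.

Lemma boundary_boundary n (c : chain_bimodule n.+1) :
  boundary n (boundary n.+1 c) = 0.
Proof. case: n c => [|n] c //; exact: boundary_fun_boundary. Qed.

Definition directed_homology (n : nat) :
  bimodule (path_algebra R S) (path_algebra R' S) :=
  homology_bimodule (boundary n.+1) (boundary n).

Definition homology_object (n : nat) : bimod_obj R R' :=
  @BimodObj R R' (path_algebra R S) (path_algebra R' S) (directed_homology n).
End Chains.

(* Main.v *)
(* A simplicially enriched functor acts on the basis simplices of the path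
   algebras and of the chain bimodules.  This action commutes with faces and
   degeneracies, and preserves definedness of composites as soon as the functor
   is injective on objects; only then is it compatible with the products and
   actions, which are zero on non-composable pairs.  Isomorphisms are injective
   on objects, so they induce bimodule morphisms of chains, hence of homology,
   and functoriality makes the two induced morphisms mutually inverse. *)
Require Import Defs.
From mathcomp Require Import all_boot all_algebra.
From mathcomp Require Import boolp.
From mathcomp.multinomials Require Import monalg.

Set Implicit Arguments.
Unset Strict Implicit.
Unset Printing Implicit Defensive.

Import GRing.Theory.
Local Open Scope ring_scope.

(** * Change of basis index in free modules *)

Section Reindex.
Variables (G : zmodType) (K L : choiceType) (h : K -> L).

Definition mreindex (x : {malg G[K]}) : {malg G[L]} :=
  mlift (fun k c => << c *g h k >>) x.

Let phiD k : {morph (fun c : G => << c *g h k >> : {malg G[L]}) :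
  c d / c + d}.
Proof. by move=> c d; rewrite monalgUD. Qed.

Lemma mreindexD : {morph mreindex : x y / x + y}.
Proof. exact: mliftD. Qed.

Lemma mreindexU c k : mreindex << c *g k >> = << c *g h k >>.
Proof. exact: mliftU. Qed.

Lemma mreindex0 : mreindex 0 = 0.
Proof. exact: morphD0 mreindexD. Qed.
End Reindex.

Lemma mreindexK (G : zmodType) (K L : choiceType) (h : K -> L) (g : L -> K) :
  cancel h g -> cancel (@mreindex G K L h) (mreindex g).
Proof.
move=> hK; apply: malg_ext => [x y|x y|k c] //; first by rewrite !mreindexD.
by rewrite !mreindexU hK.
Qed.

Lemma mreindex_scale (R : comPzRingType) (K L : choiceType) (h : K -> L)
    (r : R) (x : freemod R K) :
  mreindex h (r *: x) = r *: (mreindex h x : freemod R L).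
Proof.
move: x; apply: malg_ext => [x y|x y|k c].
- by rewrite scalerDr mreindexD.
- by rewrite mreindexD scalerDr.
by rewrite freemodZU !mreindexU freemodZU.
Qed.

Section ReindexProd.
Variables (K1 K2 K3 L1 L2 L3 : choiceType) (G1 G2 G3 : zmodType).
Variables (op : K1 -> K2 -> option K3) (op' : L1 -> L2 -> option L3).
Variables (mu : G1 -> G2 -> G3).
Variables (h1 : K1 -> L1) (h2 : K2 -> L2) (h3 : K3 -> L3).
Hypothesis muDl : forall d, {morph mu^~ d : c c' / c + c'}.
Hypothesis muDr : forall c, {morph mu c : d d' / d + d'}.
Hypothesis oph : forall k l, op' (h1 k) (h2 l) = omap h3 (op k l).

(** By biadditivity it suffices to compare generators. There [oph], an equality of options, also
    matches undefined products, so zero products go to zero. *)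
Lemma mreindex_mprod x y :
  mreindex h3 (mprod op mu x y) =
  mprod op' mu (mreindex h1 x) (mreindex h2 y).
Proof.
move: x; apply: malg_ext => [x x'|x x'|k c].
- by rewrite mprodDl // mreindexD.
- by rewrite mreindexD mprodDl.
move: y; apply: malg_ext => [y y'|y y'|l d].
- by rewrite mprodDr // mreindexD.
- by rewrite mreindexD mprodDr.
rewrite !mreindexU !mprodUU // oph; case: (op k l) => [m|] /=.
- exact: mreindexU.
- exact: mreindex0.
Qed.
End ReindexProd.

(** * Action of an enriched functor on simplices *)

Section SimplexMap.
Variables (S T : secat) (F : sfunctor S T).

Definition simplex_map n (s : simplices S n) : simplices T n :=
  Simplex (fhom F n (cell s)).

Lemma simplex_map_face n (j : 'I_n.+2) (s : simplices S n.+1) :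
  simplex_map (face_simplex j s) = face_simplex j (simplex_map s).
Proof. by rewrite /simplex_map /face_simplex /= smap_face. Qed.

Lemma simplex_map_degs n (f : simplices S 0) :
  simplex_map (degs_simplex n f) = degs_simplex n (simplex_map f).
Proof.
rewrite /simplex_map /degs_simplex /=; congr Simplex.
by elim: n => //= n <-; rewrite smap_deg.
Qed.

Hypothesis F_inj : injective F.

Lemma compo_simplex_map n (t s : simplices S n) :
  compo (simplex_map t) (simplex_map s) =
  omap (@simplex_map n) (compo t s).
Proof.
have [e|ne] := pselect (tgt s = src t); last first.
  (* Without injectivity the images of a non-composable pair could compose. *)
  by rewrite !compo_None // => /F_inj.
case: s t e => [A B s] [B' C t] /= e; subst B'.
by rewrite /simplex_map compoE /= compoE /= fhom_comp.
Qed.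
End SimplexMap.

Lemma simplex_mapK (S T : secat) (F : sfunctor S T) (G : sfunctor T S) n :
  sfunctor_comp G F = sfunctor_id S ->
  cancel (@simplex_map S T F n) (@simplex_map T S G n).
Proof.
(* The two maps compose by conversion to that of [sfunctor_comp G F]; rewriting this functor as a
   whole avoids transporting cells along equalities of objects. *)
move=> GF s; rewrite -[LHS]/(simplex_map (sfunctor_comp G F) s) GF.
by case: s.
Qed.

Lemma bimod_hom_eq (R R' : comPzRingType) (X Y : bimod_obj R R')
    (u v : bimod_hom X Y) :
  bhoml u =1 bhoml v -> bhom u =1 bhom v -> bhomr u =1 bhomr v -> u = v.
Proof.
case: u v => [f g h p1 p2 p3 p4 p5 p6] [f' g' h' q1 q2 q3 q4 q5 q6] /=.
move=> /funext ef /funext eg /funext eh; subst f' g' h'.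
by congr BimodHom; exact: Prop_irrelevance.
Qed.

(** * Maps induced on homology *)

Section HomologyHom.
Variables (R R' : comPzRingType).

(** Both actions on homology are instances of [hmap], which can be computed on any representative
    once the action is known to stabilize cycles and boundaries. *)
Lemma homology_actE (A : algebra R) (B : algebra R') (L M N : bimodule A B)
    (d1 : bimodule_map L M) (d0 : bimodule_map M N) a (z : cycles d0) b :
  ract (lact a (hclass d1 z : homology_bimodule d1 d0)) b =
  hclass d1 (in_cycles d0 (ract (lact a (cycv z)) b)).
Proof.
have st_l : stabilizes d1 d0 (lact a).
  split=> [|c dc|c]; first exact: lactDr.
  - by rewrite bmap_lact dc (morphD0 (lactDr a)).
  - by exists (lact a c); rewrite bmap_lact.
have st_r : stabilizes d1 d0 (ract^~ b).
  split=> [|c dc|c]; first exact: ractDl.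
  - by rewrite bmap_ract dc (morphD0 (ractDl b)).
  - by exists (ract c b); rewrite bmap_ract.
rewrite /= !hmapE // cycv_in //.
by case: st_l => _ + _; apply; exact: cycleP.
Qed.

Variables (A A' : algebra R) (B B' : algebra R').
Variables (L M N : bimodule A B) (L' M' N' : bimodule A' B').
Variables (d1 : bimodule_map L M) (d0 : bimodule_map M N).
Variables (d1' : bimodule_map L' M') (d0' : bimodule_map M' N').

(** What a chain map gives in a single degree; no components on [L] or [N] have to be carried
    along. *)
Definition preserves_homology (phi : M -> M') : Prop :=
  [/\ {morph phi : x y / x + y},
      forall c, d0 c = 0 -> d0' (phi c) = 0
    & forall c, exists c', d1' c' = phi (d1 c)].

Definition homology_map (phi : M -> M') (h : homology d1 d0) :
    homology d1' d0' :=
  hclass d1' (in_cycles d0' (phi (cycv (repr h)))).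

(** Independence of the representative: two choices differ by a boundary, which [phi] sends to a
    boundary. *)
Lemma homology_mapE phi z : preserves_homology phi ->
  homology_map phi (hclass d1 z) = hclass d1' (in_cycles d0' (phi (cycv z))).
Proof.
case=> phiD phi0 phi1; apply/hclass_eq.
rewrite !cycv_in ?phi0 ?cycleP // -(morphDB phiD).
have /hclass_eq[c <-] : hclass d1 (repr (hclass d1 z)) = hclass d1 z.
  exact: reprK.
exact: phi1.
Qed.

Lemma homology_mapD phi : preserves_homology phi ->
  {morph homology_map phi : x y / x + y}.
Proof.
move=> ph; case: (ph) => phiD phi0 _.
elim/hclass_ind=> x; elim/hclass_ind=> y.
rewrite -hclassD !homology_mapE // -hclassD.
congr hclass; apply/cycv_inj.
by rewrite [RHS]cycvD !cycv_in ?phi0 ?cycleP // cycvD phiD.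
Qed.

Variable u : bimod_hom (BimodObj M) (BimodObj M').
Hypothesis u_homology : preserves_homology (bhom u).

Lemma homology_map_act a (m : homology_bimodule d1 d0) b :
  homology_map (bhom u) (ract (lact a m) b) =
  ract (lact (bhoml u a) (homology_map (bhom u) m : homology_bimodule d1' d0'))
    (bhomr u b).
Proof.
case: (u_homology) => _ u0 _.
move: m; elim/hclass_ind => z.
rewrite homology_actE !homology_mapE // homology_actE.
congr hclass; congr in_cycles.
(* Both arguments of [in_cycles] are cycles, so its default value 0 never intervenes and the
   identity reduces to the one on chains. *)
rewrite (cycv_in (u0 _ (cycleP z))) cycv_in; first exact: (bhom_act u).
rewrite bmap_ract bmap_lact cycleP.
by rewrite (morphD0 (lactDr a)) (morphD0 (ractDl b)).
Qed.

Definition homology_hom :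
  bimod_hom (BimodObj (homology_bimodule d1 d0))
            (BimodObj (homology_bimodule d1' d0')) :=
  @BimodHom R R' (BimodObj (homology_bimodule d1 d0))
    (BimodObj (homology_bimodule d1' d0'))
    (bhoml u) (homology_map (bhom u)) (bhomr u)
    (bhoml_linear u) (@bhomlM _ _ _ _ u) (homology_mapD u_homology)
    (bhomr_linear u) (@bhomrM _ _ _ _ u) homology_map_act.
End HomologyHom.
Arguments homology_map {R R' A A' B B' L M N L' M' N'} d1 d0 d1' d0' phi h.

Lemma homology_mapK (R R' : comPzRingType) (A A' : algebra R)
    (B B' : algebra R') (L M N : bimodule A B) (L' M' N' : bimodule A' B')
    (d1 : bimodule_map L M) (d0 : bimodule_map M N)
    (d1' : bimodule_map L' M') (d0' : bimodule_map M' N')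
    (phi : M -> M') (psi : M' -> M) :
  preserves_homology d1 d0 d1' d0' phi ->
  preserves_homology d1' d0' d1 d0 psi ->
  cancel phi psi ->
  cancel (homology_map d1 d0 d1' d0' phi) (homology_map d1' d0' d1 d0 psi).
Proof.
move=> phi_h psi_h phiK; elim/hclass_ind => z.
rewrite !homology_mapE //; congr hclass; apply/cycv_inj.
case: phi_h => _ phi0 _.
by rewrite (cycv_in (phi0 _ (cycleP z))) phiK cycv_in // cycleP.
Qed.

(** * Morphisms induced by a functor on path algebras, chains and homology *)

Section Induced.
Variables (R R' : comPzRingType) (S T : secat) (F : sfunctor S T).

(** The coefficient ring [P] is a parameter, to be taken as [R] on the left and [R'] on the
    right. *)
Definition path_map (P : comPzRingType) :
    path_algebra P S -> path_algebra P T :=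
  @mreindex P (simplices S 0) (simplices T 0) (@simplex_map S T F 0).

Definition chain_map n : chain R R' S n -> chain R R' T n :=
  mreindex (@simplex_map S T F n).

Lemma path_map_linear (P : comPzRingType) : linear (@path_map P).
Proof.
move=> r x y; rewrite /path_map mreindexD; congr (_ + _).
exact: mreindex_scale.
Qed.

Lemma chain_map_boundary n (c : chain R R' S n.+1) :
  chain_map (boundary_fun c) = boundary_fun (chain_map c).
Proof.
rewrite /chain_map; move: c; apply: malg_ext => [x y|x y|s t].
- by rewrite boundary_funD mreindexD.
- by rewrite mreindexD boundary_funD.
rewrite mreindexU !boundary_funU.
rewrite (big_morph _ (mreindexD _) (mreindex0 _ _)).
apply: eq_bigr => j _.
by rewrite (morphDMz (mreindexD _)) mreindexU simplex_map_face.
Qed.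

Lemma chain_map_homology n :
  preserves_homology (boundary R R' S n.+1) (boundary R R' S n)
    (boundary R R' T n.+1) (boundary R R' T n) (@chain_map n).
Proof.
split; first exact: mreindexD.
(* In degree 0 the boundary is the zero map, so every chain is a cycle. *)
- case: n => [|n] c // dc.
  by rewrite /= -chain_map_boundary [boundary_fun c]dc /chain_map mreindex0.
- by move=> c; exists (chain_map c); rewrite /= chain_map_boundary.
Qed.

Hypothesis F_inj : injective F.

Lemma path_mapM (P : comPzRingType) :
  {morph @path_map P : x y / amul x y}.
Proof.
move=> x y; apply: mreindex_mprod => [d c c'|c d d'|k l].
- by rewrite mulrDl.
- by rewrite mulrDr.
- exact: compo_simplex_map.
Qed.

Lemma chain_map_act n a (c : chain R R' S n) b :
  chain_map (chain_ract (chain_lact a c) b) =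
  chain_ract (chain_lact (path_map a) (chain_map c)) (path_map b).
Proof.
rewrite /chain_map /chain_ract /chain_lact /path_map.
(* The two-sided action is a nested [mprod]: the inner left action is handled first, then the outer
   right one. Compatibility with degeneracies turns each into preservation of composites of
   [n]-simplices. *)
rewrite -(mreindex_mprod (op := fun f s => compo (degs_simplex n f) s)
  (h3 := @simplex_map S T F n)).
- apply: mreindex_mprod => [q|t|s g]; first exact: trscaleDl.
    exact: trscaleDr.
  by rewrite -simplex_map_degs compo_simplex_map.
- exact: tlscaleDl.
- exact: tlscaleDr.
- by move=> f s; rewrite -simplex_map_degs compo_simplex_map.
Qed.

Definition chain_hom n :
  bimod_hom (BimodObj (chain_bimodule R R' S n))
            (BimodObj (chain_bimodule R R' T n)) :=
  @BimodHom R R' (BimodObj (chain_bimodule R R' S n))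
    (BimodObj (chain_bimodule R R' T n))
    (@path_map R) (@chain_map n) (@path_map R')
    (@path_map_linear R) (@path_mapM R) (mreindexD _)
    (@path_map_linear R') (@path_mapM R') (@chain_map_act n).

Definition directed_homology_hom n :
    bimod_hom (homology_object R R' S n) (homology_object R R' T n) :=
  homology_hom (u := chain_hom n) (chain_map_homology n).
End Induced.

(** * Functoriality and invariance under isomorphism *)

Lemma directed_homology_homK (R R' : comPzRingType) (S T : secat)
    (F : sfunctor S T) (G : sfunctor T S)
    (F_inj : injective F) (G_inj : injective G) n :
  sfunctor_comp G F = sfunctor_id S ->
  bimod_comp (directed_homology_hom R R' G_inj n)
    (directed_homology_hom R R' F_inj n) =
  bimod_id (homology_object R R' S n).
Proof.
move=> GF; have sK k := simplex_mapK (n := k) GF.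
(* Simplices of degree 0 settle the two algebra components, those of degree [n] the homology
   component. *)
apply: bimod_hom_eq.
- exact: mreindexK (sK 0).
- apply: homology_mapK; [exact: chain_map_homology.. |].
  exact: mreindexK (sK n).
- exact: mreindexK (sK 0).
Qed.

(** Evaluated on objects, the equality of functors makes [G] a left inverse of [F]. *)
Lemma sfunctor_comp_id_inj (S T : secat) (F : sfunctor S T)
    (G : sfunctor T S) :
  sfunctor_comp G F = sfunctor_id S -> injective F.
Proof.
by move=> GF; apply: (can_inj (g := G)) => A; exact: (congr1 (fun H : sfunctor S S => H A) GF).
Qed.

Theorem corollary19 (R R' : comPzRingType) (S T : secat)
    (isoST : secat_iso S T) (n : nat) :
  bimod_iso (homology_object R R' S n) (homology_object R R' T n).
Proof.
case: isoST => F [G [GF FG]].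
exists (directed_homology_hom R R' (sfunctor_comp_id_inj GF) n).
exists (directed_homology_hom R R' (sfunctor_comp_id_inj FG) n).
by split; apply: directed_homology_homK.
Qed.
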